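(* For every integer $n\ge 2$, all finite index subgroups of $\Gamma_n$ have property $R_\infty$.
   Context: For an integer $n\ge 2$ with prime decomposition $n=p_1^{y_1}\cdots p_r^{y_r}$ (the $p_i$ pairwise distinct primes, $y_i\ge 1$), $$\Gamma_n=\langle a,t_1,\dots,t_r\mid t_it_j=t_jt_i\ (i\ne j),\ t_iat_i^{-1}=a^{p_i^{y_i}}\ (i=1,\dots,r)\rangle.$$ A group $G$ has property $R_\infty$ if for every $\varphi\in\mathrm{Aut}(G)$ the number $R(\varphi)$ of equivalence classes of the relation on $G$ given by $g\sim h\iff zg\varphi(z)^{-1}=h$ for some $z\in G$ is infinite. *)

(* Defs.v *)
From HB Require Import structures.
From mathcomp Require Import all_boot.
From mathcomp Require Import boolp classical_sets functions cardinality.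

Set Implicit Arguments.
Unset Strict Implicit.
Unset Printing Implicit Defensive.

Local Open Scope classical_set_scope.
Local Open Scope quotient_scope.
Local Open Scope group_scope.

(* A letter (x, false) stands for the generator x, and (x, true) for its
   formal inverse; a word is read as the product of its letters. *)
Definition word (X : Type) : Type := seq (X * bool).

Definition word_inv (X : Type) (w : word X) : word X :=
  rev [seq (l.1, ~~ l.2) | l <- w].

(* The smallest congruence on words that contains free cancellation and the
   defining relations: [rels u v] is the relation u = v. *)
Inductive word_eqv (X : Type) (rels : word X -> word X -> Prop) :
    word X -> word X -> Prop :=
| WordRefl u : word_eqv rels u u
| WordSym u v : word_eqv rels u v -> word_eqv rels v u
| WordTrans u v w :
    word_eqv rels u v -> word_eqv rels v w -> word_eqv rels u w
| WordCat u u' v v' :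
    word_eqv rels u u' -> word_eqv rels v v' ->
    word_eqv rels (u ++ v) (u' ++ v')
| WordCancel x b : word_eqv rels [:: (x, b); (x, ~~ b)] [::]
| WordRel u v : rels u v -> word_eqv rels u v.

Section Presentation.
Variables (X : choiceType) (rels : word X -> word X -> Prop).

Definition word_eqb (u v : seq (X * bool)) : bool := `[< word_eqv rels u v >].

Lemma word_eqb_refl : reflexive word_eqb.
Proof. by move=> u; apply/asboolP; exact: WordRefl. Qed.

Lemma word_eqb_sym : symmetric word_eqb.
Proof. by move=> u v; apply/asboolP/asboolP; exact: WordSym. Qed.

Lemma word_eqb_trans : transitive word_eqb.
Proof.
by move=> v u w /asboolP uv /asboolP vw; apply/asboolP; exact: WordTrans vw.
Qed.

Canonical word_equiv := EquivRel word_eqb word_eqb_refl word_eqb_sym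
  word_eqb_trans.

Definition presented : Type := {eq_quot word_equiv}.
HB.instance Definition _ := Choice.on presented.
HB.instance Definition _ := EqQuotient.on presented.

Definition pword (w : seq (X * bool)) : presented := \pi_presented w.

Lemma pword_eqP u v : pword u = pword v <-> word_eqv rels u v.
Proof.
rewrite /pword; split.
  by move=> /eqmodP /asboolP.
by move=> ?; apply/eqmodP/asboolP.
Qed.

Definition pres_one : presented := pword [::].
Definition pres_mul (x y : presented) : presented :=
  pword (repr x ++ repr y).
Definition pres_inv (x : presented) : presented := pword (word_inv (repr x)).

Lemma repr_pword u : word_eqv rels (repr (pword u)) u.
Proof. by apply/pword_eqP; rewrite /pword reprK. Qed.

Lemma pwordK (x : presented) : pword (repr x) = x.
Proof. by rewrite /pword reprK. Qed.

Lemma word_invK : involutive (@word_inv X).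
Proof.
move=> w; rewrite /word_inv map_rev revK -map_comp -[RHS]map_id.
by apply: eq_map => -[x b] /=; rewrite negbK.
Qed.

Lemma word_inv_cat (u v : word X) :
  word_inv (u ++ v) = word_inv v ++ word_inv u.
Proof. by rewrite /word_inv map_cat rev_cat. Qed.

Lemma word_mulV (u : word X) : word_eqv rels (u ++ word_inv u) [::].
Proof.
elim: u => [|[x b] u IHu]; first exact: WordRefl.
rewrite -cat1s word_inv_cat [word_inv [:: _]]/= -catA (catA u).
apply: WordTrans (WordCancel rels x b).
apply: (@WordCat _ _ [:: (x, b)] [:: (x, b)]); first exact: WordRefl.
apply: (@WordCat _ _ _ [::] [:: (x, ~~ b)]); [exact: IHu|exact: WordRefl].
Qed.

Lemma word_mulVr (u : word X) : word_eqv rels (word_inv u ++ u) [::].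
Proof. by have := word_mulV (word_inv u); rewrite word_invK. Qed.

Lemma pres_mulE u v : pres_mul (pword u) (pword v) = pword (u ++ v).
Proof. by apply/pword_eqP; apply: WordCat; exact: repr_pword. Qed.

Lemma pres_mulA : associative pres_mul.
Proof.
move=> x y z; rewrite -(pwordK x) -(pwordK y) -(pwordK z) !pres_mulE.
by rewrite catA.
Qed.

Lemma pres_mul1 : left_id pres_one pres_mul.
Proof. by move=> x; rewrite -(pwordK x) pres_mulE. Qed.

Lemma pres_mul1r : right_id pres_one pres_mul.
Proof. by move=> x; rewrite -(pwordK x) pres_mulE cats0. Qed.

Lemma pres_mulV : left_inverse pres_one pres_inv pres_mul.
Proof.
move=> x; rewrite -{2}(pwordK x) pres_mulE; apply/pword_eqP.
exact: word_mulVr.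
Qed.

Lemma pres_mulVr : right_inverse pres_one pres_inv pres_mul.
Proof.
move=> x; rewrite -{1}(pwordK x) pres_mulE; apply/pword_eqP.
exact: word_mulV.
Qed.

HB.instance Definition _ := isGroup.Build presented
  pres_mulA pres_mul1 pres_mul1r pres_mulV pres_mulVr.

Definition gen (x : X) : presented := pword [:: (x, false)].

Definition word_eval (K : groupType) (f : X -> K) (w : word X) : K :=
  \prod_(l <- w) (if l.2 then (f l.1)^-1 else f l.1).

Lemma pword_eval w : pword w = word_eval gen w.
Proof.
elim: w => [|[x b] w IHw]; first by rewrite /word_eval big_nil.
rewrite /word_eval big_cons -[X in _ = _ * X]IHw -cat1s -pres_mulE.
congr (_ * _); case: b => //=.
apply: (mulgI (gen x)); rewrite mulgV [_ * _]pres_mulE.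
by apply/pword_eqP; exact: WordCancel.
Qed.

Lemma gen_rel u v : rels u v -> word_eval gen u = word_eval gen v.
Proof. by move=> uv; rewrite -!pword_eval; apply/pword_eqP; exact: WordRel. Qed.

Lemma word_eval_eqv (K : groupType) (f : X -> K) u v :
  (forall u' v', rels u' v' -> word_eval f u' = word_eval f v') ->
  word_eqv rels u v -> word_eval f u = word_eval f v.
Proof.
move=> frel; elim=> {u v} //.
- by move=> u v w _ -> _ ->.
- move=> u u' v v' _ eu _ ev.
  by rewrite /word_eval !big_cat; congr (_ * _).
- move=> x b; rewrite /word_eval !big_cons big_nil mulg1 /=.
  by case: b; rewrite /= ?mulgV ?mulVg.
Qed.

Lemma presented_univ (K : groupType) (f : X -> K) :
  (forall u v, rels u v -> word_eval f u = word_eval f v) ->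
  exists phi : {multiplicative presented -> K}, forall x, phi (gen x) = f x.
Proof.
move=> frel; pose phi (x : presented) := word_eval f (repr x).
have phiE w : phi (pword w) = word_eval f w.
  by apply: word_eval_eqv => //; exact: repr_pword.
have phiM : {morph phi : x y / x * y}.
  move=> x y; rewrite -(pwordK x) -(pwordK y) [_ * _]pres_mulE !phiE.
  by rewrite /word_eval big_cat.
pose phiM' := isMultiplicative.Build _ _ phi phiM.
pose phi' : {multiplicative presented -> K} := HB.pack phi phiM'.
by exists phi' => x; rewrite [LHS]phiE /word_eval big_seq1.
Qed.

Lemma presented_univ_uniq (K : groupType)
    (phi psi : {multiplicative presented -> K}) :
  (forall x, phi (gen x) = psi (gen x)) -> phi =1 psi.
Proof.
have E (h : {multiplicative presented -> K}) w :
    h (pword w) = word_eval (h \o gen) w.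
  have h1 : h 1 = 1.
    by apply: (mulgI (h 1)); rewrite -gmulfM !mulg1.
  rewrite pword_eval /word_eval; elim: w => [|[x b] w IHw].
    by rewrite !big_nil.
  rewrite !big_cons gmulfM IHw; congr (_ * _); case: b => //=.
  by apply: (mulgI (h (gen x))); rewrite -gmulfM !mulgV.
move=> e x; rewrite -(pwordK x) !E /word_eval.
by apply: eq_bigr => l _ /=; rewrite e.
Qed.

End Presentation.

(* [primes n] is the increasing list of the prime divisors of n; the relations
   below are symmetric in the p_i, so their order is irrelevant. *)
Definition nprimes (n : nat) : nat := size (primes n).
Definition prime_of (n : nat) (i : 'I_(nprimes n)) : nat := nth 0 (primes n) i.
Definition ppart_of (n : nat) (i : 'I_(nprimes n)) : nat :=
  (prime_of i ^ logn (prime_of i) n)%N.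

(* The generator [None] is a, and [Some i] is t_i. *)
Definition Gamma_gen (n : nat) := option 'I_(nprimes n).

Inductive Gamma_rel (n : nat) :
    word (Gamma_gen n) -> word (Gamma_gen n) -> Prop :=
| Gamma_comm (i j : 'I_(nprimes n)) : i <> j ->
    Gamma_rel [:: (Some i, false); (Some j, false)]
              [:: (Some j, false); (Some i, false)]
| Gamma_conj (i : 'I_(nprimes n)) :
    Gamma_rel [:: (Some i, false); (None, false); (Some i, true)]
              (nseq (ppart_of i) (None, false)).

Definition Gamma (n : nat) : groupType := presented (@Gamma_rel n).

(* A subgroup is a boolean predicate closed under the group operations; with
   classical logic every Prop-valued subset is one, through [asbool]. *)
Section Subgroup.
Variables (G : groupType) (H : groupClosed G).

Definition subgroup : Type := {x : G | x \in H}.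

Lemma subgroup_closed : group_closed (fun x : G => x \in H).
Proof.
split; first exact: (gpred1 (s := H)).
by move=> x y xH yH; rewrite !unfold_in; exact: gpredF.
Qed.

HB.instance Definition _ := SubChoice.on subgroup.
HB.instance Definition _ :=
  SubChoice_isSubGroup.Build G (fun x => x \in H) subgroup subgroup_closed.

Definition left_coset (g : G) : set G := [set g * h | h in [set` H]].

Definition finite_index : Prop := finite_set (range left_coset).

End Subgroup.

Definition twisted_conj (G : groupType) (phi : G -> G) (g h : G) : Prop :=
  exists z, z * g * (phi z)^-1 = h.

Definition twisted_class (G : groupType) (phi : G -> G) (g : G) : set G :=
  [set h | twisted_conj phi g h].

Definition property_Rinfty (G : groupType) : Prop :=
  forall phi : {multiplicative G -> G}, bijective phi ->
    infinite_set (range (twisted_class phi)).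

(* Main.v *)
Require Import Defs.
From HB Require Import structures.
From mathcomp Require Import all_boot all_order all_algebra.
From mathcomp Require Import boolp classical_sets functions cardinality.

(** The group Gamma_n acts on the rational line by positive affine maps: a acts
    as x |-> x + 1 and t_i as x |-> p_i^y_i x.  The plan is to show that an
    automorphism phi of a finite index subgroup H cannot change the slope of
    this action ([slope_invariant]).  A twisted conjugate z g phi(z)^-1 of g
    then has the same slope as g, while the powers of a suitable t_i^l in H have
    pairwise distinct slopes, so there are infinitely many twisted classes
    ([affine_Rinfty]).

    Why slopes are preserved.  Let b = a^m lie in H.  Every h in H satisfies
    h b^d h^-1 = b^c for some positive c and d, and the slope of h is then
    c / d, since conjugating a translation scales it by the slope.  Applying
    phi gives phi(h) phi(b)^d phi(h)^-1 = phi(b)^c with the same c and d; if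
    phi(b) is again a nontrivial translation, the slope of phi(h) is also c / d.
    It is a translation because t_i^l b t_i^-l = b^q with q > 1: the slope of
    phi(b) equals its own q-th power and is positive, hence is 1.  It is
    nontrivial because phi is injective and the action is faithful.

    Two facts on Gamma_n remain.  Both the faithfulness of the action
    ([rep_inj]) and the commensuration relation h a^d = a^c h ([commensurated])
    follow from writing each g as a fraction (a^k T)^-1 (a^j T') with T and T'
    monomials in the t_i ([fraction_form]).  For faithfulness, unique
    factorization is what recovers the monomial T from its slope
    ([weight_inj]). *)

Import Order.TTheory GRing.Theory Num.Theory.

Set Implicit Arguments.
Unset Strict Implicit.
Unset Printing Implicit Defensive.

(** * The positive affine group of a line *)

(** The pair (l, v) stands for the map x |-> l x + v.  Requiring l > 0, and not
    only l != 0, leaves 1 as the only root of unity among the slopes. *)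
Definition affine (F : numFieldType) : Type := {p : F * F | (0 < p.1)%R}.

Section Affine.
Local Open Scope ring_scope.
Variable F : numFieldType.

HB.instance Definition _ := SubChoice.on (affine F).

Definition slope (x : affine F) : F := (val x).1.
Definition shift (x : affine F) : F := (val x).2.

Lemma slope_gt0 x : 0 < slope x.
Proof. exact: valP x. Qed.

Lemma slope_neq0 x : slope x != 0.
Proof. by rewrite gt_eqF ?slope_gt0. Qed.

Definition aff (l v : F) (l_gt0 : 0 < l) : affine F := exist _ (l, v) l_gt0.

Lemma affP (x y : affine F) : slope x = slope y -> shift x = shift y -> x = y.
Proof.
move=> el ev; apply: val_inj; move: el ev; rewrite /slope /shift.
by case: (val x) (val y) => [l v] [l' v'] /= -> ->.
Qed.

Definition aff_one : affine F := aff 0 ltr01.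
Definition aff_mul (x y : affine F) : affine F :=
  aff (shift x + slope x * shift y) (mulr_gt0 (slope_gt0 x) (slope_gt0 y)).

Lemma invr_slope_gt0 x : 0 < (slope x)^-1.
Proof. by rewrite invr_gt0 slope_gt0. Qed.

Definition aff_inv (x : affine F) : affine F :=
  aff (- ((slope x)^-1 * shift x)) (invr_slope_gt0 x).

Lemma aff_mulA : associative aff_mul.
Proof.
move=> x y z; apply: affP; rewrite /slope /shift /=; first exact: mulrA.
by rewrite mulrDr addrA mulrA.
Qed.

Lemma aff_mul1 : left_id aff_one aff_mul.
Proof. by move=> x; apply: affP; rewrite /slope /shift /= !mul1r ?add0r. Qed.

Lemma aff_mul1r : right_id aff_one aff_mul.
Proof.
by move=> x; apply: affP; rewrite /slope /shift /= ?mulr1 ?mulr0 ?addr0.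
Qed.

Lemma aff_mulV : left_inverse aff_one aff_inv aff_mul.
Proof.
move=> x; apply: affP; last by rewrite /shift /slope /= addNr.
by apply: mulVf; exact: slope_neq0.
Qed.

Lemma aff_mulVr : right_inverse aff_one aff_inv aff_mul.
Proof.
move=> x; apply: affP; first by apply: mulfV; exact: slope_neq0.
rewrite [LHS]/(shift x + slope x * - ((slope x)^-1 * shift x)).
rewrite mulrN mulVKf ?slope_neq0 //.
exact: subrr.
Qed.

HB.instance Definition _ := isGroup.Build (affine F)
  aff_mulA aff_mul1 aff_mul1r aff_mulV aff_mulVr.

Lemma slopeM (x y : affine F) : slope (x * y)%g = slope x * slope y.
Proof. by []. Qed.

Lemma shiftM (x y : affine F) :
  shift (x * y)%g = shift x + slope x * shift y.
Proof. by []. Qed.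

Lemma shift1 : shift 1%g = 0. Proof. by []. Qed.

Lemma slopeV (x : affine F) : slope x^-1%g = (slope x)^-1.
Proof. by []. Qed.

Lemma slopeX (x : affine F) k : slope (x ^+ k)%g = slope x ^+ k.
Proof. by elim: k => // k IHk; rewrite expgS exprS slopeM IHk. Qed.

Lemma shiftX (x : affine F) k : slope x = 1 -> shift (x ^+ k)%g = shift x *+ k.
Proof.
move=> x1; elim: k => // k IHk.
by rewrite expgS mulrS shiftM x1 mul1r IHk.
Qed.

(** Conjugation by y multiplies a translation by the slope of y, so a relation
    between x^d and x^c with x a nonzero translation determines that slope. *)
Lemma slope_conj_translation (x y : affine F) c d :
    slope x = 1 -> shift x != 0 -> (y * x ^+ d = x ^+ c * y)%g ->
  slope y * d%:R = c%:R.
Proof.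
move=> x1 v0 /(congr1 shift); rewrite !shiftM slopeX x1 expr1n mul1r !shiftX //.
rewrite [RHS]addrC => /addrI.
rewrite -[shift x *+ d]mulr_natl -[shift x *+ c]mulr_natl mulrA.
exact: mulIf.
Qed.

(** Slopes commute, so the relation makes the slope l of x satisfy l = l^c; as
    l > 0, this leaves only l = 1. *)
Lemma translation_of_conjX (x y : affine F) c :
  (1 < c)%N -> (y * x = x ^+ c * y)%g -> slope x = 1.
Proof.
move=> c_gt1 /(congr1 slope); rewrite !slopeM slopeX mulrC => /mulIf E.
have {E} := E (slope_neq0 y).
case: c c_gt1 => [//|c] c_gt0; rewrite exprS -{1}[slope x]mulr1.
move=> /(mulfI (slope_neq0 x)) /esym /eqP.
by rewrite pexpr_eq1 ?(ltW (slope_gt0 x)) // => /eqP.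
Qed.

End Affine.

(** * Multiplicative maps between groups *)

(** A multiplicative map carries compatibility with products only; between
    groups the rest follows by cancellation. *)
Section MultiplicativeGroups.
Variables (G K : groupType) (f : {multiplicative G -> K}).
Local Open Scope group_scope.

Lemma mult_one : f 1 = 1.
Proof. by apply: (mulgI (f 1)); rewrite -gmulfM !mulg1. Qed.

Lemma mult_inv x : f x^-1 = (f x)^-1.
Proof. by apply: (mulgI (f x)); rewrite -gmulfM !mulgV mult_one. Qed.

Lemma mult_exp x k : f (x ^+ k) = f x ^+ k.
Proof.
elim: k => [|k IHk]; first exact: mult_one.
by rewrite !expgS gmulfM IHk.
Qed.

End MultiplicativeGroups.

Lemma mulg_exp_swap (G : groupType) (x y z : G) k :
  (y * x = z * y -> y * x ^+ k = z ^+ k * y)%g.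
Proof.
move=> E; elim: k => [|k IHk]; first by rewrite mulg1 mul1g.
by rewrite expgSr mulgA IHk -mulgA E mulgA -expgSr.
Qed.

(** * Powers in subgroups of finite index *)

Lemma infinite_setS (T : Type) (A : set T) (f : nat -> T) :
  injective f -> (forall k, A (f k)) -> infinite_set A.
Proof.
move=> f_inj Af finA; apply: infinite_nat.
have -> : setT = (f @^-1` A)%classic.
  by apply/seteqP; split=> k // _; exact: Af.
by apply: finite_preimage finA => i j _ _; exact: f_inj.
Qed.

(** Pigeonhole on the cosets of the powers of g: g^i H = g^j H with i < j puts
    g^(j - i) in H. *)
Lemma finite_index_exp (G : groupType) (H : groupClosed G) (g : G) :
  finite_index H -> exists2 m, 0 < m & (g ^+ m)%g \in H.
Proof.
move=> finH; apply: contrapT => noPow; move: finH.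
apply: (@infinite_setS _ _ (fun k => left_coset H (g ^+ k)%g)); last first.
  by move=> k; exists (g ^+ k)%g.
have lt_neq i j : i < j -> left_coset H (g ^+ i)%g <> left_coset H (g ^+ j)%g.
  move=> lt_ij eq_ij; apply: noPow.
  have: left_coset H (g ^+ j)%g (g ^+ j)%g.
    by exists 1%g; [exact: (gpred1 (s := H)) | rewrite mulg1].
  rewrite -eq_ij => -[h hH gih]; exists (j - i); first by rewrite subn_gt0.
  suff -> : (g ^+ (j - i))%g = h by [].
  by apply: (mulgI (g ^+ i)%g); rewrite gih -expgnDr subnKC ?(ltnW lt_ij).
move=> i j eq_ij; apply/eqP; case: ltngtP => // lt_ij.
  by case: (lt_neq _ _ lt_ij).
by case: (lt_neq _ _ lt_ij).
Qed.

(** * A criterion for property R-infinity *)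

(** The criterion is about an abstract group G acting faithfully on a line, with
    an element b commensurated by G and an element t that expands b.  Nothing
    is assumed on the slope of b: that it is a translation follows from [tb]. *)
Section Criterion.
Variables (F : numFieldType) (G : groupType).
Variables (rho : {multiplicative G -> affine F}) (b t : G) (q : nat).
Hypothesis rho_inj : injective rho.
Hypothesis b_neq1 : b <> 1%g.
Hypothesis q_gt1 : 1 < q.
Hypothesis tb : (t * b = b ^+ q * t)%g.
Hypothesis b_comm : forall h, exists c d,
  0 < d /\ (h * b ^+ d = b ^+ c * h)%g.

(** The relation [tb] is a property of the pair (t, b) that phi transports, and
    it forces translations. *)
Lemma injective_translation (phi : {multiplicative G -> G}) : injective phi ->
  slope (rho (phi b)) = 1%R /\ shift (rho (phi b)) != 0%R.
Proof.
move=> phi_inj.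
have phib1 : slope (rho (phi b)) = 1%R.
  apply: (translation_of_conjX (y := rho (phi t)) q_gt1).
  by rewrite -!mult_exp -!gmulfM tb.
split=> //; apply: contra_notN b_neq1 => /eqP v0.
apply: phi_inj; apply: rho_inj; rewrite !mult_one.
exact: affP.
Qed.

(** The slope of h is c / d for any relation h b^d = b^c h, and phi preserves
    the exponents of such a relation. *)
Lemma slope_invariant (phi : {multiplicative G -> G}) (h : G) :
  injective phi -> slope (rho (phi h)) = slope (rho h).
Proof.
move=> phi_inj; have [c [d [d_gt0 E]]] := b_comm h.
have slopeE (psi : {multiplicative G -> G}) :
    injective psi -> (slope (rho (psi h)) * d%:R = c%:R)%R.
  move=> /injective_translation [b1 bv].
  apply: (slope_conj_translation b1 bv).
  by rewrite -!mult_exp -!gmulfM E.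
have id_inj : injective (idfun : {multiplicative G -> G}) by [].
have d_neq0 : (d%:R != 0 :> F)%R by rewrite pnatr_eq0 -lt0n.
by apply: (mulIf d_neq0); rewrite slopeE // (slopeE idfun).
Qed.

Lemma affine_Rinfty : property_Rinfty G.
Proof.
move=> phi /bij_inj phi_inj.
apply: (@infinite_setS _ _ (fun k => twisted_class phi (t ^+ k)%g)); last first.
  by move=> k; exists (t ^+ k)%g.
move=> i j eq_ij.
have: twisted_class phi (t ^+ j)%g (t ^+ j)%g.
  by exists 1%g; rewrite mult_one mul1g invg1 mulg1.
(* Take slopes in z t^i phi(z)^-1 = t^j: those of z and phi(z) cancel. *)
rewrite -eq_ij => -[z /(congr1 (fun x => slope (rho x))) /=].
rewrite !gmulfM mult_inv !slopeM slopeV slope_invariant // mulrAC.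
rewrite mulfV ?slope_neq0 // mul1r !mult_exp !slopeX.
(* The slope of t is the integer q > 1, so its powers are distinct. *)
have [b1 bv] := @injective_translation idfun (@inj_id G).
have := slope_conj_translation (d := 1) (c := q) (y := rho t) b1 bv.
rewrite expg1 -mult_exp -!gmulfM tb mulr1 => -> //.
move/eqP; rewrite -!natrX eqr_nat eqn_exp2l //; exact/eqP.
Qed.

End Criterion.

(** * Monomials in the stable letters *)

Section Monomials.
Variable n : nat.
Local Notation I := 'I_(nprimes n).

(** A monomial in the t_i is recorded as the list of its factors, whose order is
    immaterial; its weight is the factor by which it scales a. *)
Definition weight (s : seq I) : nat := \prod_(i <- s) ppart_of i.

Lemma prime_of_prime (i : I) : prime (prime_of i).
Proof.
have: prime_of i \in primes n by rewrite mem_nth.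
by rewrite mem_primes => /andP[].
Qed.

Lemma prime_of_inj : injective (@prime_of n).
Proof.
move=> i j /eqP; rewrite nth_uniq ?ltn_ord ?primes_uniq // => /eqP.
exact: val_inj.
Qed.

Lemma logn_prime_of_gt0 (i : I) : 0 < logn (prime_of i) n.
Proof. by rewrite logn_gt0 mem_nth. Qed.

Lemma ppart_of_gt0 (i : I) : 0 < ppart_of i.
Proof. by rewrite expn_gt0 prime_gt0 ?prime_of_prime. Qed.

Lemma ppart_of_gt1 (i : I) : 1 < ppart_of i.
Proof.
by rewrite -(exp1n (logn (prime_of i) n)) ltn_exp2r ?logn_prime_of_gt0
  ?prime_gt1 ?prime_of_prime.
Qed.

Lemma weight_cons i s : weight (i :: s) = ppart_of i * weight s.
Proof. exact: big_cons. Qed.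

Lemma weight_gt0 s : 0 < weight s.
Proof. by apply: prodn_gt0 => i; exact: ppart_of_gt0. Qed.

Lemma logn_weight (i : I) s :
  logn (prime_of i) (weight s) = count_mem i s * logn (prime_of i) n.
Proof.
elim: s => [|j s IHs]; first by rewrite /weight big_nil logn1.
rewrite weight_cons lognM ?ppart_of_gt0 ?weight_gt0 // IHs /= mulnDl.
congr (_ + _); rewrite lognX (logn_prime _ (prime_of_prime j)).
rewrite (inj_eq prime_of_inj) eq_sym.
by case: eqVneq => [->|_]; rewrite ?muln1 ?mul1n ?muln0.
Qed.

(** Distinct p_i make the p_i-adic valuation of the weight a multiple of the
    multiplicity of i, so the weight determines the multiplicities. *)
Lemma weight_inj s s' : weight s = weight s' -> perm_eq s s'.
Proof.
move=> eq_w; apply/allP => i _ /=; apply/eqP.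
have /eqP := congr1 (logn (prime_of i)) eq_w.
by rewrite !logn_weight eqn_pmul2r ?logn_prime_of_gt0 // => /eqP.
Qed.

Definition ga : Gamma n := gen _ None.
Definition gt (i : I) : Gamma n := gen _ (Some i).

Local Open Scope group_scope.

Lemma gt_comm (i j : I) : commute (gt i) (gt j).
Proof.
have [<-//|/eqP ij] := eqVneq i j.
have := gen_rel (Gamma_comm ij).
by rewrite /word_eval !big_cons !big_nil !mulg1.
Qed.

Lemma gt_ga (i : I) : gt i * ga = ga ^+ ppart_of i * gt i.
Proof.
have := gen_rel (Gamma_conj i).
rewrite /word_eval !big_cons big_nil big_nseq mulg1 /= iter_mulg_1 => <-.
by rewrite mulgA mulgVK.
Qed.

Definition mono (s : seq I) : Gamma n := \prod_(i <- s) gt i.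

Lemma mono_cons i s : mono (i :: s) = gt i * mono s.
Proof. exact: big_cons. Qed.

Lemma mono_cat s s' : mono (s ++ s') = mono s * mono s'.
Proof. exact: big_cat. Qed.

Lemma gt_mono i s : commute (gt i) (mono s).
Proof. by apply: commute_prod => j _; exact: gt_comm. Qed.

Lemma mono_comm s s' : commute (mono s) (mono s').
Proof.
by apply/commute_prod => j _; apply: commute_sym; exact: gt_mono.
Qed.

Lemma mono_perm s s' : perm_eq s s' -> mono s = mono s'.
Proof.
apply: catCA_perm_subst => s1 s2 s3; rewrite !mono_cat !mulgA.
by congr (_ * _); exact: mono_comm.
Qed.

Lemma gt_gaX i k : gt i * ga ^+ k = ga ^+ (ppart_of i * k) * gt i.
Proof. by rewrite expgnA; apply: mulg_exp_swap; exact: gt_ga. Qed.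

Lemma mono_gaX s k : mono s * ga ^+ k = ga ^+ (weight s * k) * mono s.
Proof.
elim: s => [|i s IHs] in k *.
  by rewrite /mono /weight !big_nil mul1n mulg1 mul1g.
by rewrite mono_cons -mulgA IHs mulgA gt_gaX weight_cons mulgA mulnA.
Qed.

Lemma gtX_gaX i l k :
  gt i ^+ l * ga ^+ k = ga ^+ (ppart_of i ^ l * k) * gt i ^+ l.
Proof.
have := mono_gaX (nseq l i) k.
by rewrite /mono /weight !big_nseq iter_mulg_1 iter_muln_1.
Qed.

Lemma Gamma_ind (P : Gamma n -> Prop) : P 1 ->
    (forall g, P g -> P (ga * g)) -> (forall g, P g -> P (ga^-1 * g)) ->
    (forall i g, P g -> P (gt i * g)) ->
    (forall i g, P g -> P ((gt i)^-1 * g)) ->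
  forall g, P g.
Proof.
move=> P1 Pa Pa' Pt Pt' g; rewrite -(pwordK g) pword_eval /word_eval.
elim: (repr g) => [|[[i|] [|]] w IHw]; rewrite ?big_nil // big_cons /=.
- exact: Pt'.
- exact: Pt.
- exact: Pa'.
- exact: Pa.
Qed.

(** Multiplying g on the left by a generator keeps this form: a positive
    letter moves left past the denominator and is absorbed by the numerator, and
    an inverse letter is cancelled by enlarging the denominator.  Natural
    exponents suffice because both sides carry a power of a. *)
Lemma fraction_form (g : Gamma n) : exists k s j s',
  ga ^+ k * mono s * g = ga ^+ j * mono s'.
Proof.
elim/Gamma_ind: g => [|g|g|i g|i g].
- by exists 0, [::], 0, [::]; rewrite mulg1.
- move=> [k [s [j [s' E]]]]; exists k, s, (weight s + j)%N, s'.
  rewrite expgnDr -[RHS]mulgA -E !mulgA -expgnDr -[_ * mono s * ga]mulgA.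
  by rewrite (mono_gaX s 1) muln1 mulgA -expgnDr addnC.
- move=> [k [s [j [s' E]]]]; exists (k + weight s)%N, s, j, s'.
  rewrite -E expgnDr -(muln1 (weight s)) -[_ * _ * mono s]mulgA -mono_gaX.
  by rewrite -!mulgA mulVKg.
- move=> [k [s [j [s' E]]]].
  exists (ppart_of i * k)%N, s, (ppart_of i * j)%N, (i :: s').
  rewrite mono_cons [RHS]mulgA -gt_gaX -[RHS]mulgA -E !mulgA gt_gaX.
  by rewrite -[in RHS](mulgA _ (gt i)) gt_mono mulgA.
- move=> [k [s [j [s' E]]]]; exists k, (i :: s), j, s'.
  by rewrite mono_cons gt_mono -E -!mulgA mulVKg.
Qed.

End Monomials.

(** * The affine representation *)

Section Representation.
Variable n : nat.
Local Notation I := 'I_(nprimes n).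

Lemma ppart_gt0_rat (i : I) : (0 < (ppart_of i)%:R :> rat)%R.
Proof. by rewrite ltr0n ppart_of_gt0. Qed.

Definition rep_gen (x : Gamma_gen n) : affine rat :=
  if x is Some i then aff 0%R (ppart_gt0_rat i) else aff 1%R (@ltr01 rat).

Lemma slope_rep_ga k : slope (rep_gen None ^+ k)%g = 1%R.
Proof. by rewrite slopeX expr1n. Qed.

Lemma shift_rep_ga k : shift (rep_gen None ^+ k)%g = (k%:R)%R.
Proof. by rewrite shiftX. Qed.

Lemma rep_exists :
  exists rho : {multiplicative Gamma n -> affine rat},
    forall x, rho (gen _ x) = rep_gen x.
Proof.
apply: presented_univ => u v [i j _ | i].
  rewrite /word_eval !big_cons !big_nil !mulg1.
  by apply: affP; rewrite ?slopeM ?shiftM /slope /shift /= ?mulr0 // mulrC.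
rewrite /word_eval big_nseq !big_cons big_nil mulg1 iter_mulg_1.
apply: (mulIg (rep_gen (Some i))); rewrite mulgA mulgVK.
apply: affP; first by rewrite !slopeM slope_rep_ga mulrC.
rewrite !shiftM slope_rep_ga shift_rep_ga /shift /slope /=.
by rewrite add0r mulr1 mulr0 addr0.
Qed.

Definition rep : {multiplicative Gamma n -> affine rat} :=
  projT1 (cid rep_exists).

Lemma rep_gt i : rep (gt i) = rep_gen (Some i).
Proof. exact: (projT2 (cid rep_exists)). Qed.

Lemma rep_ga : rep (ga n) = rep_gen None.
Proof. exact: (projT2 (cid rep_exists)). Qed.

Lemma rep_mono s :
  slope (rep (mono s)) = ((weight s)%:R)%R /\ shift (rep (mono s)) = 0%R.
Proof.
elim: s => [|i s [IHl IHv]].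
  by rewrite /mono /weight !big_nil mult_one.
rewrite mono_cons gmulfM slopeM shiftM IHl IHv mulr0 addr0 rep_gt.
by rewrite weight_cons natrM.
Qed.

Lemma rep_fraction k s :
  slope (rep (ga n ^+ k * mono s)%g) = ((weight s)%:R)%R /\
  shift (rep (ga n ^+ k * mono s)%g) = (k%:R)%R.
Proof.
have [ml mv] := rep_mono s.
rewrite gmulfM mult_exp rep_ga slopeM shiftM slope_rep_ga shift_rep_ga.
by rewrite ml mv mul1r mulr0 addr0.
Qed.

(** If g acts trivially, the numerator and the denominator of a fraction for g
    are the same affine map; its shift gives the power of a and its slope the
    monomial, so they are already equal in Gamma_n. *)
Lemma rep_inj : injective rep.
Proof.
suff ker1 g : rep g = 1%g -> g = 1%g.
  move=> x y eq_xy; apply: (mulIg y^-1%g); rewrite mulgV; apply: ker1.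
  by rewrite gmulfM mult_inv eq_xy mulgV.
move=> g1; have [k [s [j [s' E]]]] := fraction_form g.
have [l1 v1] := rep_fraction k s; have [l2 v2] := rep_fraction j s'.
rewrite -E gmulfM g1 mulg1 in l2 v2.
have /eqP := etrans (esym l1) l2; rewrite eqr_nat => /eqP /weight_inj ss'.
have /eqP := etrans (esym v1) v2; rewrite eqr_nat => /eqP kj.
apply: (mulgI (ga n ^+ k * mono s)%g).
by rewrite mulg1 E kj (mono_perm ss').
Qed.

(** For g = (a^k T)^-1 (a^j T'), the exponents are the weights of T' and T: both
    sides, multiplied by a^k T, are a^(weight T * weight T') times a^j T'. *)
Lemma commensurated (g : Gamma n) : exists c d,
  0 < d /\ (g * ga n ^+ d = ga n ^+ c * g)%g.
Proof.
have [k [s [j [s' E]]]] := fraction_form g.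
exists (weight s'), (weight s); split; first exact: weight_gt0.
apply: (mulgI (ga n ^+ k * mono s)%g).
rewrite !mulgA E -[in LHS]mulgA mono_gaX mulgA -expgnDr.
rewrite -[in RHS](mulgA _ (mono s)) mono_gaX mulgA -expgnDr.
rewrite addnC [k + _]addnC !expgnDr -!mulgA; congr (_ * _)%g.
  by rewrite mulnC.
by rewrite mulgA E.
Qed.

End Representation.

(** * Finite index subgroups of Gamma_n *)

Theorem corollary5p3 (n : nat) (hn : 2 <= n) (H : groupClosed (Gamma n)) :
  finite_index H -> property_Rinfty (subgroup H).
Proof.
move=> finH.
pose rho : {multiplicative subgroup H -> affine rat} := rep n \o val.
(* Any prime divisor of n will do. *)
have i : 'I_(nprimes n).
  apply: (@Ordinal _ 0); rewrite /nprimes -has_predT; apply/hasP.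
  by exists (pdiv n); rewrite // mem_primes pdiv_prime // pdiv_dvd (ltnW hn).
have [m m_gt0 am] := finite_index_exp (ga n) finH.
have [l l_gt0 tl] := finite_index_exp (gt i) finH.
pose b : subgroup H := exist (fun x => x \in H) _ am.
pose t : subgroup H := exist (fun x => x \in H) _ tl.
have valX := mult_exp (\val : {multiplicative subgroup H -> Gamma n}).
apply: (@affine_Rinfty _ _ rho b t (ppart_of i ^ l)).
- by apply: inj_comp; [exact: rep_inj | exact: val_inj].
- move=> b1; have := shift_rep_ga n m.
  rewrite -rep_ga -mult_exp -[(ga n ^+ m)%g]/(val b) b1 mult_one shift1.
  by move/eqP; rewrite eq_sym pnatr_eq0 -leqn0 leqNgt m_gt0.
- by rewrite -(exp1n l) ltn_exp2r ?ppart_of_gt1.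
- apply: val_inj; rewrite !valM valX /= -expgnA mulnC.
  exact: gtX_gaX.
move=> h; have [c [d [d_gt0 E]]] := commensurated (val h).
exists c, d; split=> //; apply: val_inj; rewrite !valM !valX /=.
by rewrite !(expgnAC (ga n) m); exact: mulg_exp_swap.
Qed.
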